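(* Let $A\in\mathbb{C}^{m\times n}$ and $B\in\mathbb{C}^{n\times \ell}$, and let $M,N,L$ be weights of order $m,n,\ell$ respectively. If $A^{[\dagger]}$ and $B^{[\dagger]}$ exist, then $$\operatorname{rank}\left(BB^{[\dagger]}A^{[\dagger]}A-A^{[\dagger]}ABB^{[\dagger]}\right)=2\operatorname{rank}\begin{pmatrix}A^{[*]} & B\end{pmatrix}+2\operatorname{rank}(AB)-2\operatorname{rank}(A)-2\operatorname{rank}(B).$$
   Context: All matrices are complex and $X^*$ denotes the complex conjugate transpose. A weight of order $n$ is an invertible Hermitian $n\times n$ matrix (not necessarily positive definite). The spaces $\mathbb{C}^m,\mathbb{C}^n,\mathbb{C}^\ell$ carry fixed weights $M,N,L$. The adjoint of a matrix $X\in\mathbb{C}^{p\times q}$ between spaces with weights $W_p$ (on $\mathbb{C}^p$) and $W_q$ (on $\mathbb{C}^q$) is $X^{[*]}=W_q^{-1}X^*W_p$; thus $A^{[*]}=N^{-1}A^*M$, $B^{[*]}=L^{-1}B^*N$. The Moore-Penrose inverse $X^{[\dagger]}$ of $X\in\mathbb{C}^{p\times q}$ is the unique $Y\in\mathbb{C}^{q\times p}$, if it exists, satisfying $XYX=X$, $YXY=Y$, $(XY)^{[*]}=XY$ and $(YX)^{[*]}=YX$, where square matrices $Z$ acting on a space with weight $W$ have $Z^{[*]}=W^{-1}Z^*W$. It need not exist. $\begin{pmatrix}A^{[*]} & B\end{pmatrix}$ is the $n\times(m+\ell)$ block row matrix. *)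

(* Defs.v *)
From mathcomp Require Export all_boot all_order all_algebra.
From mathcomp Require Export spectral.
From mathcomp.real_closed Require Export complex.
From mathcomp Require Export reals.

Set Implicit Arguments.
Unset Strict Implicit.
Unset Printing Implicit Defensive.

Import Order.TTheory GRing.Theory Num.Theory Num.Def.
Local Open Scope ring_scope.
Local Open Scope sesquilinear_scope.

Section Weighted.
Context {C : numClosedFieldType}.

(* Nothing is assumed on the signature of W: a weight may be indefinite. *)
Definition is_weight n (W : 'M[C]_n) : Prop :=
  (W \in unitmx) /\ (W \is hermsymmx).

(* X maps (C^q, Wq) to (C^p, Wp). *)
Definition wadj p q (Wp : 'M[C]_p) (Wq : 'M[C]_q) (X : 'M[C]_(p, q)) :
  'M[C]_(q, p) := invmx Wq *m X ^t* *m Wp.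

Definition is_mpinv p q (Wp : 'M[C]_p) (Wq : 'M[C]_q)
    (X : 'M[C]_(p, q)) (Y : 'M[C]_(q, p)) : Prop :=
  [/\ X *m Y *m X = X,
      Y *m X *m Y = Y,
      wadj Wp Wp (X *m Y) = X *m Y
    & wadj Wq Wq (Y *m X) = Y *m X].

Lemma wadjM n (W : 'M[C]_n) (X Y : 'M[C]_n) : W \in unitmx ->
  wadj W W (X *m Y) = wadj W W Y *m wadj W W X.
Proof.
move=> Wu; rewrite /wadj trmx_mul map_mxM !mulmxA; congr (_ *m _ *m _).
by rewrite -[RHS]mulmxA mulmxV // mulmx1.
Qed.

Lemma is_mpinv_uniq p q (Wp : 'M[C]_p) (Wq : 'M[C]_q)
    (X : 'M[C]_(p, q)) (Y Z : 'M[C]_(q, p)) :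
  is_weight Wp -> is_weight Wq ->
  is_mpinv Wp Wq X Y -> is_mpinv Wp Wq X Z -> Y = Z.
Proof.
move=> [Up _] [Uq _] [Y1 Y2 Y3 Y4] [Z1 Z2 Z3 Z4].
have eXY : X *m Y = X *m Z.
  rewrite -{1}Z1 -mulmxA -[in LHS]Y3 -[in LHS]Z3 -wadjM //.
  by rewrite mulmxA Y1 Z3.
have eYX : Y *m X = Z *m X.
  rewrite -{1}Z1 -mulmxA mulmxA -[in LHS]Y4 -[in LHS]Z4 -wadjM //.
  by rewrite -mulmxA [X *m _]mulmxA Y1 Z4.
by rewrite -Y2 -mulmxA eXY mulmxA eYX Z2.
Qed.

End Weighted.

(* Main.v *)
Require Import Defs.
From mathcomp Require Import zify.

Import Order.TTheory GRing.Theory Num.Theory.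
Local Open Scope ring_scope.

(** Put [P = Ad *m A] and [Q = B *m Bd].  Both are idempotents that are
    self-adjoint for the weight [N], and the matrix of the theorem is their
    commutator up to sign.  For arbitrary idempotents,
      [P Q - Q P = (P - Q) (P + Q - 1)],
    and the left kernel of [P + Q - 1] lies in the row space of [P - Q], so the
    rank of the commutator is [rank (P - Q) + rank (P + Q - 1) - n].

    The left kernel of [P + Q - 1] is the direct sum of the vectors of the row
    space of [P] that [Q] kills and of those of the row space of [Q] that [P]
    kills; this expresses [rank (P + Q - 1)] through the ranks of [P], [Q],
    [P Q] and [Q P] ([mxrank_idem_add_sub1]).  The same formula for [P] and the
    complementary idempotent [1 - Q] gives [rank (P - Q)], and together they
    give [mxrank_idem_commutator], where only the four products of [P] with
    [Q] and [1 - Q] remain.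

    Self-adjointness pairs these four products, since taking the adjoint
    preserves the rank and reverses products: this is where both factors 2 come
    from.  Finally [rank (P Q) = rank (A B)] because [P] and [A] have the same
    kernel and [Q] and [B] the same image, and [(1 - Q) P] measures what the
    image of [P], which is also the image of the adjoint of [A], adds to that
    of [B]. *)

(** * Ranks of products of idempotents *)

Section IdempotentRank.
Set Implicit Arguments.
Unset Strict Implicit.
Context {F : fieldType} {n : nat}.
Implicit Types P Q : 'M[F]_n.

Lemma idem_compl Q : Q *m Q = Q -> (1%:M - Q) *m (1%:M - Q) = 1%:M - Q.
Proof.
by move=> QQ; rewrite mulmxBl mul1mx mulmxBr mulmx1 QQ subrr subr0.
Qed.

Lemma kermx_idem_compl Q : Q *m Q = Q -> (kermx (1%:M - Q) == Q)%MS.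
Proof.
move=> QQ; apply/andP; split; last first.
  by apply/sub_kermxP; rewrite mulmxBr mulmx1 QQ subrr.
have := mulmx_ker (1%:M - Q); rewrite mulmxBr mulmx1 => /eqP.
by rewrite subr_eq0 => /eqP ->; apply: submxMl.
Qed.

Lemma mxrank_idem_compl Q : Q *m Q = Q -> (\rank (1%:M - Q)%R + \rank Q)%N = n.
Proof.
move=> QQ; rewrite -(eqmx_rank (kermx_idem_compl QQ)) mxrank_ker.
by rewrite subnKC // rank_leq_row.
Qed.

(** Right multiplication by [1 - Q] kills exactly the row space of [Q]. *)
Lemma mxrank_col_mx_idem p (X : 'M[F]_(p, n)) Q : Q *m Q = Q ->
  \rank (col_mx X Q)%R = (\rank Q + \rank (X *m (1%:M - Q))%R)%N.
Proof.
move=> QQ; have := mxrank_mul_ker X (1%:M - Q).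
rewrite (cap_eqmx (eqmx_refl X) (eqmxP (kermx_idem_compl QQ))).
have := mxrank_sum_cap X Q; rewrite (addsmxE X Q).
lia.
Qed.

Lemma mxrank_row_mx_idem p (X : 'M[F]_(n, p)) Q : Q *m Q = Q ->
  \rank (row_mx X Q)%R = (\rank Q + \rank ((1%:M - Q) *m X)%R)%N.
Proof.
move=> QQ; rewrite -mxrank_tr tr_row_mx mxrank_col_mx_idem.
  by rewrite -[1%:M - _]trmxK linearB /= trmx1 trmxK -trmx_mul !mxrank_tr.
by rewrite -trmx_mul QQ.
Qed.

(** A vector [u] with [u = u P + u Q] satisfies [u P Q = u Q P = 0], so the two
    summands lie in the row space of one idempotent and in the kernel of the
    other. *)
Lemma kermx_idem_add_sub1 P Q : P *m P = P -> Q *m Q = Q ->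
  (kermx (P + Q - 1%:M) == (P :&: kermx Q) + (Q :&: kermx P))%MS.
Proof.
move=> PP QQ; apply/andP; split.
  set K := kermx _; have := mulmx_ker (P + Q - 1%:M); rewrite -/K.
  rewrite mulmxBr mulmx1 mulmxDr => /eqP; rewrite subr_eq0 => /eqP eK.
  have KQP : K *m Q *m P = 0.
    apply: (addrI (K *m P)).
    by rewrite addr0 -{1}PP mulmxA -mulmxDl eK.
  have KPQ : K *m P *m Q = 0.
    apply: (addIr (K *m Q)).
    by rewrite add0r -{2}QQ mulmxA -mulmxDl eK.
  by rewrite -{1}eK; apply: addmx_sub_adds; rewrite sub_capmx submxMl;
    apply/sub_kermxP.
rewrite addsmx_sub; apply/andP; split; apply/sub_kermxP.
  have /submxP[D eD] := capmxSl P (kermx Q).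
  have /sub_kermxP eQ := capmxSr P (kermx Q).
  by rewrite mulmxBr mulmx1 mulmxDr eQ addr0 eD -mulmxA PP subrr.
have /submxP[D eD] := capmxSl Q (kermx P).
have /sub_kermxP eP := capmxSr Q (kermx P).
by rewrite mulmxBr mulmx1 mulmxDr eP add0r eD -mulmxA QQ subrr.
Qed.

Lemma mxrank_idem_add_sub1 P Q : P *m P = P -> Q *m Q = Q ->
  (\rank (P + Q - 1%:M)%R + \rank P + \rank Q =
   n + \rank (P *m Q)%R + \rank (Q *m P)%R)%N.
Proof.
move=> PP QQ.
have := mxrank_ker (P + Q - 1%:M).
rewrite (eqmx_rank (kermx_idem_add_sub1 PP QQ)).
have := mxrank_sum_cap (P :&: kermx Q)%MS (Q :&: kermx P)%MS.
(* A vector of the row space of P that P kills is zero, so the sum is direct. *)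
have -> : \rank ((P :&: kermx Q) :&: (Q :&: kermx P))%MS = 0%N.
  set W := (_ :&: (_ :&: _))%MS.
  have /submxP[D eD] : (W <= P)%MS := submx_trans (capmxSl _ _) (capmxSl _ _).
  have /sub_kermxP eW : (W <= kermx P)%MS :=
    submx_trans (capmxSr _ _) (capmxSr _ _).
  by move: eW; rewrite eD -mulmxA PP => ->; rewrite mxrank0.
have := mxrank_mul_ker P Q; have := mxrank_mul_ker Q P.
have := rank_leq_row (P + Q - 1%:M).
lia.
Qed.

(** Every [u] with [u = u P + u Q] equals [u (P - Q) (P - Q)], because the mixed
    terms vanish on it; hence the second factor of
    [(P - Q) (P + Q - 1) = P Q - Q P] loses its full kernel. *)
Lemma mxrank_idem_commutator P Q : P *m P = P -> Q *m Q = Q ->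
  (\rank (P *m Q - Q *m P)%R + 2 * \rank P =
   \rank (P *m Q)%R + \rank (Q *m P)%R +
   (\rank (P *m (1%:M - Q))%R + \rank ((1%:M - Q) *m P)%R))%N.
Proof.
move=> PP QQ.
have eC : P *m Q - Q *m P = (P - Q) *m (P + Q - 1%:M).
  rewrite mulmxBr mulmx1 mulmxDr !mulmxBl PP QQ.
  by rewrite opprB -addrA [_ + (Q - P)]addrA subrK addrC addrA subrK.
have sK : (kermx (P + Q - 1%:M) <= P - Q)%MS.
  rewrite (eqmxP (kermx_idem_add_sub1 PP QQ)) addsmx_sub.
  apply/andP; split.
    have /submxP[D eD] := capmxSl P (kermx Q).
    have /sub_kermxP eQ := capmxSr P (kermx Q).
    apply/submxP; exists (P :&: kermx Q)%MS.
    by rewrite mulmxBr eQ subr0 {2}eD -mulmxA PP.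
  have /submxP[D eD] := capmxSl Q (kermx P).
  have /sub_kermxP eP := capmxSr Q (kermx P).
  apply/submxP; exists (- (Q :&: kermx P)%MS).
  by rewrite mulNmx mulmxBr eP sub0r opprK {2}eD -mulmxA QQ.
have := mxrank_mul_ker (P - Q) (P + Q - 1%:M).
rewrite -eC (capmx_idPr sK) mxrank_ker.
have := rank_leq_row (P + Q - 1%:M).
have := mxrank_idem_add_sub1 PP QQ.
have := mxrank_idem_add_sub1 PP (idem_compl QQ).
have -> : P + (1%:M - Q) - 1%:M = P - Q by rewrite [P + _]addrCA [LHS]addrC addKr.
have := mxrank_idem_compl QQ.
lia.
Qed.

(** When the products pair up in rank, as they do for self-adjoint idempotents,
    the term of [(1 - Q) P] can be read off from the block matrix. *)
Lemma mxrank_idem_commutator_row_mx P Q : P *m P = P -> Q *m Q = Q ->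
  \rank (Q *m P)%R = \rank (P *m Q)%R ->
  \rank (P *m (1%:M - Q))%R = \rank ((1%:M - Q) *m P)%R ->
  (\rank (P *m Q - Q *m P)%R + 2 * \rank P + 2 * \rank Q =
   2 * \rank (row_mx P Q)%R + 2 * \rank (P *m Q)%R)%N.
Proof.
move=> PP QQ eQP eQ'P; have := mxrank_idem_commutator PP QQ.
rewrite eQP eQ'P (mxrank_row_mx_idem P QQ).
lia.
Qed.

End IdempotentRank.

(** * Weighted adjoints and Moore-Penrose projectors *)

Section WeightedRank.
Set Implicit Arguments.
Unset Strict Implicit.
Context {C : numClosedFieldType}.

Lemma wadj_mul p q r (Wp : 'M[C]_p) (Wq : 'M[C]_q) (Wr : 'M[C]_r)
    (X : 'M[C]_(p, q)) (Y : 'M[C]_(q, r)) : Wq \in unitmx ->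
  wadj Wp Wr (X *m Y) = wadj Wq Wr Y *m wadj Wp Wq X.
Proof.
move=> Wu; rewrite /wadj trmx_mul map_mxM !mulmxA; congr (_ *m _ *m _).
by rewrite -[RHS]mulmxA mulmxV // mulmx1.
Qed.

Lemma wadj_compl n (W X : 'M[C]_n) : W \in unitmx ->
  wadj W W (1%:M - X) = 1%:M - wadj W W X.
Proof.
move=> Wu; rewrite /wadj linearB /= map_mxB trmx1 map_mx1.
by rewrite mulmxBr mulmxBl mulmx1 mulVmx.
Qed.

Lemma mxrank_wadj p q (Wp : 'M[C]_p) (Wq : 'M[C]_q) (X : 'M[C]_(p, q)) :
  Wp \in unitmx -> Wq \in unitmx -> \rank (wadj Wp Wq X)%R = \rank X.
Proof.
move=> Up Uq; rewrite /wadj mxrankMfree ?row_free_unit //.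
rewrite eqmxMfull ?row_full_unit ?unitmx_inv //.
by rewrite mxrank_map mxrank_tr.
Qed.

Lemma mxrank_selfadj_mulC n (W X Y : 'M[C]_n) : W \in unitmx ->
  wadj W W X = X -> wadj W W Y = Y -> \rank (X *m Y)%R = \rank (Y *m X)%R.
Proof.
move=> Wu eX eY.
by rewrite -(mxrank_wadj (X *m Y) Wu Wu) wadjM // eX eY.
Qed.

Lemma mxrank_selfadj_idem_commutator n (W P Q : 'M[C]_n) : W \in unitmx ->
  wadj W W P = P -> wadj W W Q = Q -> P *m P = P -> Q *m Q = Q ->
  (\rank (P *m Q - Q *m P)%R + 2 * \rank P + 2 * \rank Q =
   2 * \rank (row_mx P Q)%R + 2 * \rank (P *m Q)%R)%N.
Proof.
move=> Wu aP aQ PP QQ.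
have aQ' : wadj W W (1%:M - Q) = 1%:M - Q by rewrite wadj_compl ?aQ.
apply: mxrank_idem_commutator_row_mx => //.
  exact: mxrank_selfadj_mulC Wu aQ aP.
exact: mxrank_selfadj_mulC Wu aP aQ'.
Qed.

End WeightedRank.

Section InnerInverse.
Set Implicit Arguments.
Unset Strict Implicit.
Context {F : fieldType}.

Lemma mxrank_inner_inv_l p q (X : 'M[F]_(p, q)) (Y : 'M[F]_(q, p)) r
    (Z : 'M[F]_(q, r)) :
  X *m Y *m X = X -> \rank (Y *m X *m Z)%R = \rank (X *m Z)%R.
Proof.
move=> XYX; apply/eqP; rewrite eqn_leq -{1}mulmxA mxrankM_maxr /=.
by rewrite -{1}XYX -!mulmxA mxrankM_maxr.
Qed.

Lemma mxrank_inner_inv_r p q (X : 'M[F]_(p, q)) (Y : 'M[F]_(q, p)) r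
    (Z : 'M[F]_(r, p)) :
  X *m Y *m X = X -> \rank (Z *m (X *m Y))%R = \rank (Z *m X)%R.
Proof.
move=> XYX; apply/eqP; rewrite eqn_leq {1}mulmxA mxrankM_maxl /=.
by rewrite -{1}XYX mulmxA mxrankM_maxl.
Qed.

Lemma mxrank_row_mx_eq_im n p1 p2 q1 q2 (X1 : 'M[F]_(n, p1))
    (X2 : 'M[F]_(n, p2)) (Y1 : 'M[F]_(n, q1)) (Y2 : 'M[F]_(n, q2))
    (D1 : 'M_(q1, p1)) (E1 : 'M_(p1, q1)) (D2 : 'M_(q2, p2)) (E2 : 'M_(p2, q2)) :
  X1 = Y1 *m D1 -> Y1 = X1 *m E1 -> X2 = Y2 *m D2 -> Y2 = X2 *m E2 ->
  \rank (row_mx X1 X2)%R = \rank (row_mx Y1 Y2)%R.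
Proof.
move=> eX1 eY1 eX2 eY2; apply/eqP; rewrite eqn_leq; apply/andP; split.
  have -> : row_mx X1 X2 = row_mx Y1 Y2 *m block_mx D1 0 0 D2.
    by rewrite mul_row_block !mulmx0 addr0 add0r -eX1 -eX2.
  exact: mxrankM_maxl.
have -> : row_mx Y1 Y2 = row_mx X1 X2 *m block_mx E1 0 0 E2.
  by rewrite mul_row_block !mulmx0 addr0 add0r -eY1 -eY2.
exact: mxrankM_maxl.
Qed.

End InnerInverse.

Theorem theorem3p15 (R : realType) (m n l : nat)
  (A : 'M[R[i]]_(m, n)) (B : 'M[R[i]]_(n, l))
  (M : 'M[R[i]]_m) (N : 'M[R[i]]_n) (L : 'M[R[i]]_l)
  (hM : is_weight M) (hN : is_weight N) (hL : is_weight L)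
  (Ad : 'M[R[i]]_(n, m)) (Bd : 'M[R[i]]_(l, n))
  (hAd : is_mpinv M N A Ad) (hBd : is_mpinv N L B Bd) :
  (\rank (B *m Bd *m Ad *m A - Ad *m A *m B *m Bd)%R)%:Z =
    2 * (\rank (row_mx (wadj M N A) B))%:Z + 2 * (\rank (A *m B))%:Z
    - 2 * (\rank A)%:Z - 2 * (\rank B)%:Z.
Proof.
case: hM => uM _; case: hN => uN _.
case: hAd => A1 _ _ A4; case: hBd => B1 _ B3 _.
have PP : (Ad *m A) *m (Ad *m A) = Ad *m A by rewrite -mulmxA [A *m _]mulmxA A1.
have QQ : (B *m Bd) *m (B *m Bd) = B *m Bd by rewrite mulmxA B1.
have := mxrank_selfadj_idem_commutator uN A4 B3 PP QQ.
have -> : \rank (Ad *m A *m (B *m Bd) - B *m Bd *m (Ad *m A)) =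
          \rank (B *m Bd *m Ad *m A - Ad *m A *m B *m Bd).
  by rewrite -mxrank_opp opprB !mulmxA.
have -> : \rank (Ad *m A *m (B *m Bd)) = \rank (A *m B).
  by rewrite mxrank_inner_inv_l // mxrank_inner_inv_r.
have -> : \rank (Ad *m A) = \rank A.
  by rewrite -[Ad *m A]mulmx1 mxrank_inner_inv_l // mulmx1.
have -> : \rank (B *m Bd) = \rank B.
  by rewrite -[B *m Bd]mul1mx mxrank_inner_inv_r // mul1mx.
(* The adjoint of A has the image of Ad A, because Ad A is self-adjoint. *)
have -> : \rank (row_mx (Ad *m A) (B *m Bd)) = \rank (row_mx (wadj M N A) B).
  apply: (mxrank_row_mx_eq_im
            (D1 := wadj N M Ad) (E1 := wadj M N A) (D2 := Bd) (E2 := B)) => //.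
    by rewrite -{1}A4 (wadj_mul _ _ _ _ uM).
  by rewrite -{1}A1 -mulmxA (wadj_mul _ _ _ _ uN) // A4.
lia.
Qed.
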